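(* Let $k\ge 0$, $r\ge0$ and $0\le i\le r$ be integers. The number of $k$-multi-labeled Dyck paths in $\mathcal T_k(r,i)$ equals $$T_k(r,i)=(r+1)^{i-1}\binom{k(r+1)+r-1-i}{r-i}.$$
   Context: $\mathcal T_k(r,i)$ is the set of lattice paths from $(0,0)$ to $(r,r)$ using north steps $(0,1)$ and east steps $(1,0)$ that stay weakly above the line $y=x$, together with a labeling of the $r$ north steps such that each label in $\{1,2,\ldots,i\}$ is used exactly once, the remaining $r-i$ north steps receive labels from $\{\overline{k-1},\ldots,\overline{1},\overline{0}\}$ (repetitions allowed), and the labels are weakly increasing along each maximal run of consecutive north steps, with respect to the total order $\overline{k-1}<\cdots<\overline{1}<\overline{0}<1<2<\cdots<i$. Note $(r+1)^{i-1}\binom{k(r+1)+r-1-i}{r-i}=(r+1)^{i-1}\left(\!\binom{k(r+1)}{r-i}\!\right)$, the multiset coefficient. *)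

(* Defs.v *)
From mathcomp Require Import all_boot all_order all_algebra.

Set Implicit Arguments.
Unset Strict Implicit.
Unset Printing Implicit Defensive.

Import Order.TTheory GRing.Theory Num.Theory.

(* [inl a] is the barred label \overline{a}, with 0 <= a < k;
   [inr j] is the unbarred label j + 1, with 0 <= j < i. *)
Definition label (k i : nat) : finType := ('I_k + 'I_i)%type.

(* \overline{k-1} < ... < \overline{1} < \overline{0} < 1 < 2 < ... < i *)
Definition label_le (k i : nat) (x y : label k i) : bool :=
  match x, y with
  | inl a, inl b => b <= a
  | inl _, inr _ => true
  | inr _, inl _ => false
  | inr a, inr b => a <= b
  end.

(* A path together with a labeling of its north steps is a word of steps:
   [Some l] is a north step labeled l and [None] is an east step. *)
Definition step (k i : nat) : finType := option (label k i).

Definition north (k i : nat) : pred (step k i) := fun s => isSome s.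
Definition east (k i : nat) : pred (step k i) := fun s => ~~ isSome s.

(* [take m w] leads from (0,0) to the point whose coordinates are its numbers
   of east and north steps. *)
Definition is_dyck (k i r : nat) (w : seq (step k i)) : bool :=
  [&& count (@east k i) w == r, count (@north k i) w == r
    & all (fun m => count (@east k i) (take m w) <= count (@north k i) (take m w))
          (iota 0 (size w).+1)].

Definition unbarred_once (k i : nat) (w : seq (step k i)) : bool :=
  [forall j : 'I_i, count_mem (Some (inr j) : step k i) w == 1].

Definition run_le (k i : nat) (s t : step k i) : bool :=
  match s, t with
  | Some x, Some y => label_le x y
  | _, _ => true
  end.

(* Two adjacent north steps always lie in the same maximal run, so increasing
   along maximal runs is a condition on adjacent steps. *)
Definition runs_increasing (k i : nat) (w : seq (step k i)) : bool :=
  sorted (@run_le k i) w.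

Definition multi_labeled_dyck (k r i : nat) : {set (r + r).-tuple (step k i)} :=
  [set w : (r + r).-tuple (step k i) |
    [&& is_dyck r w, unbarred_once w & runs_increasing w]].

(* a (a - 1) ... (a - m + 1) / m! for an integer a: the upper argument in the
   count is -1 when k = 0 and i = r. *)
Definition binomz (a : int) (m : nat) : rat :=
  ((\prod_(j < m) (a%:~R - j%:R)) / (m`!)%:R)%R.

(* Main.v *)
(* Cutting a labeled path at its r east steps gives r + 1 sorted columns of
   labels, so such a path amounts to a distribution of the labels over r + 1
   columns subject to the Dyck condition: the first t columns hold at least t
   labels.  Without that condition there are (r+1)^i times the multiset
   coefficient ((k(r+1), r-i)) distributions, since the column of each unbarred
   label is free and the barred labels form a multiset of size r - i of pairs
   (column, label).  By the cycle lemma exactly one of the r + 1 cyclic shifts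
   of the columns of any distribution satisfies the Dyck condition. *)
Require Import Defs.
From mathcomp Require Import all_boot all_order all_algebra.
From mathcomp Require Import zify.

Set Implicit Arguments.
Unset Strict Implicit.
Unset Printing Implicit Defensive.

(** * Words of steps as lists of columns separated by east steps *)

Section Columns.
Variable L : eqType.
Implicit Types (c : seq L) (cs : seq (seq L)) (w : seq (option L)).

(** The first column is kept apart because [r] east steps delimit [r + 1] columns, never zero. *)
Definition join_columns c cs : seq (option L) :=
  map Some c ++ flatten [seq None :: map Some c' | c' <- cs].

Fixpoint columns w : seq L * seq (seq L) :=
  match w with
  | [::] => ([::], [::])
  | None :: w' => ([::], (columns w').1 :: (columns w').2)
  | Some l :: w' => (l :: (columns w').1, (columns w').2)
  end.

Lemma join_columns_cons c c' cs :
  join_columns c (c' :: cs) = map Some c ++ None :: join_columns c' cs.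
Proof. by []. Qed.

Lemma columnsK w : join_columns (columns w).1 (columns w).2 = w.
Proof. by elim: w => [|[l|] w IH] //=; rewrite -[in RHS]IH. Qed.

Lemma join_columnsK c cs : columns (join_columns c cs) = (c, cs).
Proof.
elim: cs c => [|c' cs IH]; first by elim=> [|l c IHc] //=; rewrite IHc.
by elim=> [|l c IHc]; rewrite ?join_columns_cons /= ?IH // -join_columns_cons IHc.
Qed.

Lemma count_east_join c cs : count (fun s => ~~ isSome s) (join_columns c cs) = size cs.
Proof.
elim: cs c => [|c' cs IH] c; last first.
  by rewrite join_columns_cons count_cat /= IH count_map (eq_count (a2 := pred0)) // count_pred0.
by rewrite /join_columns cats0 count_map (eq_count (a2 := pred0)) // count_pred0.
Qed.

Lemma count_north_join c cs :
  count (fun s => isSome s) (join_columns c cs) = sumn (map size (c :: cs)).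
Proof.
elim: cs c => [|c' cs IH] c; last first.
  by rewrite join_columns_cons count_cat /= IH count_map (eq_count (a2 := predT)) // count_predT.
by rewrite /join_columns cats0 count_map (eq_count (a2 := predT)) // count_predT /= addn0.
Qed.

Lemma count_label_join l c cs :
  count_mem (Some l) (join_columns c cs) = sumn (map (count_mem l) (c :: cs)).
Proof.
have count_Some c0 : count_mem (Some l) (map Some c0) = count_mem l c0.
  by rewrite count_map; apply: eq_count.
elim: cs c => [|c' cs IH] c; last first.
  by rewrite join_columns_cons count_cat /= IH count_Some.
by rewrite /join_columns cats0 count_Some /= addn0.
Qed.

(** An east step compares with everything in both directions, so it cuts the sortedness
    condition. *)
Lemma sorted_join (le : rel L) (ole : rel (option L)) :
    (forall x y, ole (Some x) (Some y) = le x y) ->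
    (forall s, ole None s) -> (forall s, ole s None) ->
  forall c cs, sorted ole (join_columns c cs) = all (sorted le) (c :: cs).
Proof.
move=> oleS oleN1 oleN2.
have sS c : sorted ole (map Some c) = sorted le c.
  by rewrite sorted_map; case: c => //= x c; apply: eq_path => y z /=.
have pN w : path ole None w = sorted ole w by case: w => //= s w; rewrite oleN1.
move=> c cs; elim: cs c => [|c' cs IH] c.
  by rewrite /join_columns cats0 sS /= andbT.
rewrite join_columns_cons -[RHS]/(sorted le c && all (sorted le) (c' :: cs)) -IH -sS.
by case: c => [|x c] /=; rewrite ?pN // cat_path /= oleN2 pN.
Qed.

(** The condition is tightest just after an east step, and the [t]-th east step comes right after
    the first [t] columns. The surplus [d] stands for north steps already taken and lets the
    induction run step by step. *)
Lemma prefix_join (d : nat) c cs :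
  (forall m, count (fun s => ~~ isSome s) (take m (join_columns c cs)) <=
             d + count (fun s => isSome s) (take m (join_columns c cs))) <->
  (forall t, t <= size cs -> t <= d + sumn (take t (map size (c :: cs)))).
Proof.
rewrite -[c]/((c, cs).1) -[cs]/((c, cs).2) -(join_columnsK c cs) columnsK.
elim: (join_columns c cs) d => {c cs} [|[l|] w IH] d /=.
- by split=> // _ [|t].
- have /= IHd := IH d.+1; split=> H.
  + move=> t tle.
    have {}H m : count (fun s => ~~ isSome s) (take m w) <=
        d.+1 + count (fun s => isSome s) (take m w).
      by move: (H m.+1) => /=; lia.
    by move: (IHd.1 H t tle); case: t tle => //= t _; lia.
  + have {}H t : t <= size (columns w).2 ->
        t <= d.+1 + sumn (take t (map size ((columns w).1 :: (columns w).2))).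
      by move=> tle; move: (H t tle); case: t tle => //= t _; lia.
    by case=> //= m; move: (IHd.2 H m); lia.
(* An east step uses up one unit of surplus; the instance at 1 shows that [d] is positive. *)
- split=> H.
  + have dgt0 : 0 < d by move: (H 1); rewrite /= take0 /=; lia.
    case=> // t tle /=; rewrite add0n.
    have Hd m : count (fun s => ~~ isSome s) (take m w) <=
        d.-1 + count (fun s => isSome s) (take m w).
      by move: (H m.+1) => /=; lia.
    by move: ((IH d.-1).1 Hd t tle) => /=; lia.
  + have dgt0 : 0 < d by move: (H 1 isT) => /=; lia.
    have Hd t : t <= size (columns w).2 ->
        t <= d.-1 + sumn (take t (map size ((columns w).1 :: (columns w).2))).
      by move=> tle; move: (H t.+1 tle) => /=; lia.
    by case=> //= m; move: ((IH d.-1).2 Hd m); lia.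
Qed.
End Columns.

(** * The cycle lemma *)

(** Extend [a] periodically, with partial sums [S]. A start [s] is good iff [S m - m] does not go
    below its value at [s] during the next [n] steps. Over a full period this quantity drops by
    exactly one, which singles out one start. *)
Lemma unique_good_rotation n (a : 'I_n.+1 -> nat) : \sum_x a x = n ->
  #|[set s : 'I_n.+1 | [forall t : 'I_n.+1,
      t <= \sum_(x < n.+1 | x < t) a (x + s)%R]]| = 1.
Proof.
move=> suma; pose b m := a (inZp m); pose S m := \sum_(0 <= x < m) b x.
have SD m t : S (m + t) = S m + \sum_(0 <= x < t) b (x + m).
  by rewrite /S (big_cat_nat (n := m)) ?leq_addr //= -{2}[m]add0n big_addn addKn.
have Speriod m : S (m + n.+1) = S m + n.
  rewrite addnC SD [RHS]addnC; congr (_ + _).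
    rewrite -[RHS]suma /S big_mkord; apply: eq_bigr => x _.
    by rewrite /b; congr a; apply: val_inj; rewrite /= modn_small.
  apply: eq_big_nat => x _; rewrite /b; congr a; apply: val_inj => /=.
  by rewrite modnDr.
have goodE (s t : 'I_n.+1) : \sum_(x < n.+1 | x < t) a (x + s)%R = S (s + t) - S s.
  rewrite SD addKn big_mkord [RHS](big_ord_widen n.+1 (fun x => b (x + s))) ?(ltnW (ltn_ord t)) //.
  by apply: eq_bigr => x _; rewrite /b; congr a; apply: val_inj.
(* The good rotation starts at the first minimum of S m - m; the key K orders
   pairs (S m - m, m) lexicographically. *)
pose K (s : 'I_n.+1) := (S s + (n - s)) * n.+1 + s.
have [s _ minK] := @arg_minnP _ (ord0 : 'I_n.+1) predT K isT.
suff -> : [set s : 'I_n.+1 | [forall t : 'I_n.+1,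
    t <= \sum_(x < n.+1 | x < t) a (x + s)%R]]
  = [set s] by rewrite cards1.
have Smono m t : S m <= S (m + t) by rewrite SD leq_addr.
have goodP (u : 'I_n.+1) : reflect (forall t, t <= n -> t + S u <= S (u + t))
    [forall t : 'I_n.+1, t <= \sum_(x < n.+1 | x < t) a (x + u)%R].
  apply: (iffP forallP) => [H t tn|H t].
    by move: (H (Ordinal (tn : t < n.+1))); rewrite goodE /=; have := Smono u t; lia.
  by rewrite goodE; have := H t (ltn_ord t : t <= n); lia.
have good_s : forall t, t <= n -> t + S s <= S (s + t).
  have min1 (y : 'I_n.+1) : S s + y <= S y + s /\ (y < s -> S s + y < S y + s).
    have := minK y isT; rewrite /K; have := ltn_ord y; have := ltn_ord s.
    by split; nia.
  move=> t tn; case: (leqP (s + t) n) => st.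
    by have [/=] := min1 (Ordinal (st : s + t < n.+1)); lia.
  (* After wrapping around, the index lies before [s], where the first minimum gives a strict
     inequality; this makes up for the unit lost over a period. *)
  have lt : s + t - n.+1 < n.+1 by have := ltn_ord s; lia.
  have [_ /=] := min1 (Ordinal lt).
  by have := Speriod (s + t - n.+1); rewrite subnK //; lia.
have uniq_good (u v : 'I_n.+1) : u < v ->
    (forall t, t <= n -> t + S u <= S (u + t)) ->
    (forall t, t <= n -> t + S v <= S (v + t)) -> False.
  move=> uv Hu Hv; have vn := ltn_ord v.
  (* Go from [u] to [v], then from [v] on to the next copy of [u]: the total drop of one is
     contradicted. *)
  have := Hu (v - u) ltac:(lia); have := Hv (u + n.+1 - v) ltac:(lia).
  by rewrite (subnKC (ltnW uv)) subnKC ?Speriod; lia.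
apply/setP=> u; rewrite !inE; apply/goodP/eqP => [Hu|->] //.
apply/val_inj; case: (ltngtP u s) => // lt; first by case: (uniq_good _ _ lt).
by case: (uniq_good _ _ lt).
Qed.

(** * Counting multisets *)

(** Stars and bars; bounding the values by [n] loses nothing, as no summand exceeds the total. For
    empty [T] the truncated predecessor still gives 1 if [n] is 0 and 0 otherwise. *)
Lemma card_ffun_sum (T : finType) n :
  #|[set g : {ffun T -> 'I_n.+1} | \sum_x g x == n :> nat]| = 'C((#|T| + n).-1, n).
Proof.
have -> : #|[set g : {ffun T -> 'I_n.+1} | \sum_x g x == n :> nat]|
    = #|[set t : #|T|.-tuple 'I_n.+1 | \sum_(x <- t) x == n :> nat]|.
  have fgraph_bij : bijective (@fgraph T 'I_n.+1).
    by exists (@Finfun T 'I_n.+1); [exact: fgraphK|exact: FinfunK].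
  rewrite -(on_card_preimset (onW_bij _ fgraph_bij)).
  apply: eq_card => g; rewrite !inE; congr (_ == _).
  by rewrite -codom_ffun big_image.
case: #|T| => [|m]; last first.
  by rewrite card_ord_partitions addSn /= -[in RHS]bin_sub ?leq_addl // addnK.
case: n => [|n].
  rewrite bin0; apply/eqP/cards1P; exists [tuple]; apply/setP => t.
  by rewrite !inE tuple0 big_nil [RHS]eqxx.
rewrite add0n bin_small //; apply/eqP; rewrite cards_eq0; apply/eqP/setP => t.
by rewrite !inE tuple0 big_nil.
Qed.

Lemma sumn_take_enum n (F : 'I_n -> nat) t :
  sumn (take t (map F (enum 'I_n))) = \sum_(x < n | x < t) F x.
Proof.
elim: n t F => [|n IH] t F; first by rewrite enum_ord0 big_ord0.
case: t => [|t]; first by rewrite take0 big_pred0.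
by rewrite enum_ordSl /= big_mkcond big_ord_recl /= -map_comp IH; congr (_ + _); rewrite big_mkcond.
Qed.

(** * The label order, and the Dyck condition in terms of column sizes *)

Lemma label_le_total k i : total (@label_le k i).
Proof. by move=> [a|a] [b|b] //=; exact: leq_total. Qed.

Lemma label_le_trans k i : transitive (@label_le k i).
Proof. by move=> [a|a] [b|b] [c|c] //=; lia. Qed.

Lemma label_le_anti k i : antisymmetric (@label_le k i).
Proof. by move=> [a|a] [b|b] //= ab; congr (_ _); apply/val_inj => /=; lia. Qed.

Lemma is_dyck_join k i r (c : seq (label k i)) cs : size cs = r ->
  is_dyck r (join_columns c cs) =
  (sumn (map size (c :: cs)) == r) &&
  all (fun t => t <= sumn (take t (map size (c :: cs)))) (iota 0 r.+1).
Proof.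
move=> cs_r; rewrite /is_dyck count_east_join count_north_join cs_r eqxx andTb.
congr (_ && _); apply/allP/allP => H.
- move=> t; rewrite mem_iota /= add0n ltnS -cs_r.
  move: t; apply/(prefix_join 0) => m; rewrite add0n.
  (* [is_dyck] tests [m] only up to the length of the word; a larger [m] takes the whole word. *)
  case: (leqP m (size (join_columns c cs))) => [le|/ltnW le].
    by apply: H; rewrite mem_iota.
  have := H (size (join_columns c cs)); rewrite mem_iota ltnSn take_size.
  by rewrite take_oversize // => ->.
- move=> m _; rewrite -[X in _ <= X]add0n.
  move: m; apply/(prefix_join 0) => t tle; rewrite add0n.
  by apply: H; rewrite mem_iota /= add0n ltnS -cs_r.
Qed.

(** * Distributions of labels over columns and their rotations *)

Section Configurations.
Variables (k r i : nat).

(* A configuration distributes the labels over the r + 1 columns: the first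
   component gives the multiplicity of each barred label in each column, the
   second the column of each unbarred label. *)
Definition config : finType :=
  ({ffun 'I_r.+1 * 'I_k -> 'I_(r - i).+1} * {ffun 'I_i -> 'I_r.+1})%type.
Implicit Types (p : config) (x s : 'I_r.+1) (l : label k i).

Definition mult p x l : nat :=
  match l with inl a => p.1 (x, a) | inr j => p.2 j == x end.

Definition col_size p x := \sum_l mult p x l.

Definition balanced p := \sum_y p.1 y == r - i :> nat.

Definition parking p :=
  [forall t : 'I_r.+1, t <= \sum_(x < r.+1 | x < t) col_size p x].

(** The signs differ because [p.1] takes a column as argument while [p.2] returns one; both bring
    column [x + s] to [x], cyclically. *)
Definition rotate s p : config :=
  ([ffun y => p.1 (y.1 + s, y.2)%R], [ffun j => p.2 j - s]%R).

Lemma mult_inj p q : mult p =2 mult q -> p = q.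
Proof.
case: p q => [g c] [g' c'] E; congr (_, _); apply/ffunP; [case=> x a|move=> j].
  by apply/val_inj; exact: (E x (inl a)).
by have := E (c j) (inr j); rewrite /= eqxx; case: eqP.
Qed.

Lemma mult_rotate s p x l : mult (rotate s p) x l = mult p (x + s)%R l.
Proof. by case: l => [a|j] /=; rewrite ffunE //= GRing.subr_eq. Qed.

Lemma rotate_inj s : injective (rotate s).
Proof.
move=> p q E; apply: mult_inj => x l.
by rewrite -[x](GRing.subrK s) -!mult_rotate E.
Qed.

Lemma sum_labels_split (q : 'I_r.+1 -> label k i -> nat) :
    (forall j, \sum_x q x (inr j) = 1) ->
  \sum_x \sum_l q x l = \sum_(y : 'I_r.+1 * 'I_k) q y.1 (inl y.2) + i.
Proof.
move=> q1; rewrite (eq_bigr _ (fun x _ => big_sumType _ _ _)) big_split /=.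
congr (_ + _); first by rewrite pair_bigA.
by rewrite exchange_big (eq_bigr (fun=> 1)) ?sum1_card ?card_ord.
Qed.

Lemma sum_mult_unbarred p j : \sum_x mult p x (inr j) = 1.
Proof.
by rewrite (bigD1 (p.2 j)) //= eqxx big1 // => x; rewrite eq_sym => /negPf ->.
Qed.

Hypothesis le_i_r : i <= r.

(** The unbarred labels always contribute [i]. In this form the condition is visibly invariant under
    rotation and supplies the hypothesis of the cycle lemma. *)
Lemma balancedE p : balanced p = (\sum_x col_size p x == r).
Proof.
rewrite sum_labels_split; last exact: sum_mult_unbarred.
rewrite /balanced; under [in RHS]eq_bigr => y _ do rewrite /= -surjective_pairing.
by rewrite -(eqn_add2r i) subnK.
Qed.

Lemma balanced_rotate s p : balanced (rotate s p) = balanced p.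
Proof.
rewrite !balancedE; congr (_ == _).
rewrite [RHS](reindex_inj (GRing.addIr s)).
by apply: eq_bigr => x _; apply: eq_bigr => l _; rewrite mult_rotate.
Qed.

Lemma config_of_mult (q : 'I_r.+1 -> label k i -> nat) :
    (forall j, \sum_x q x (inr j) = 1) -> \sum_x \sum_l q x l = r ->
  {p | balanced p & mult p =2 q}.
Proof.
move=> q1 qr; have := sum_labels_split q1; rewrite {}qr => qr.
have bound (y : 'I_r.+1 * 'I_k) : q y.1 (inl y.2) < (r - i).+1.
  rewrite ltnS -(leq_add2r i) subnK //; apply: leq_trans (eq_leq (esym qr)).
  by rewrite leq_add2r (bigD1 y) //= leq_addr.
(* By [bound], [inord] is faithful here; the default [ord0] is never reached, since [q1] puts each
   unbarred label in exactly one column. *)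
pose p : config := ([ffun y => inord (q y.1 (inl y.2))],
  [ffun j => odflt ord0 [pick x | q x (inr j) == 1]]).
have pq : mult p =2 q.
  move=> x [a|j] /=; rewrite ffunE; first by rewrite inordK // (bound (x, a)).
  have /eqP/sum_nat_eq1[y [_ y1 y0]] := q1 j.
  have qE z : q z (inr j) = (z == y).
    by case: (eqVneq z y) => [->|/y0 ->].
  case: pickP => [z|/(_ y)]; rewrite !qE ?eqxx //= eqb1 => /eqP ->.
  by rewrite eq_sym.
exists p => //; rewrite balancedE /col_size.
under eq_bigr do under eq_bigr do rewrite pq.
by rewrite sum_labels_split // -qr.
Qed.

Lemma card_balanced :
  #|[set p | balanced p]| = 'C((r.+1 * k + (r - i)).-1, r - i) * r.+1 ^ i.
Proof.
rewrite (_ : [set p | balanced p] =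
  setX [set g : {ffun 'I_r.+1 * 'I_k -> 'I_(r - i).+1} | \sum_y g y == r - i :> nat] setT).
  by rewrite cardsX card_ffun_sum cardsT card_ffun card_prod !card_ord.
by apply/setP => p; rewrite !inE andbT.
Qed.

(** Double counting of pairs of a balanced [p] and a shift [s] with [rotate s p] parking: each [p]
    has one such [s], and for each [s] rotation permutes the balanced configurations. *)
Lemma card_parking :
  r.+1 * #|[set p | balanced p && parking p]| = #|[set p | balanced p]|.
Proof.
have -> : #|[set p | balanced p]| =
    \sum_(p in [set p | balanced p]) \sum_(s | parking (rotate s p)) 1.
  rewrite -sum1_card; apply: eq_bigr => p; rewrite inE balancedE => /eqP pr.
  rewrite sum1_card -[LHS](unique_good_rotation pr); apply: eq_card => s.
  rewrite !inE; apply: eq_forallb => t; congr (_ <= _); apply: eq_bigr => x _.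
  by apply: eq_bigr => l _; rewrite mult_rotate.
rewrite (exchange_big_dep predT) //=.
transitivity (\sum_(s < r.+1) #|[set p | balanced p && parking p]|).
  by rewrite sum_nat_const card_ord.
apply: eq_bigr => s _; rewrite sum1dep_card.
rewrite -[LHS](card_preimset _ (@rotate_inj s)); apply: eq_card => p.
by rewrite !inE balanced_rotate.
Qed.

(** * The bijection between balanced parking configurations and labeled paths *)

Definition col p x : seq (label k i) :=
  sort (@label_le k i) (flatten [seq nseq (mult p x l) l | l <- enum (label k i)]).

Definition word p : seq (step k i) :=
  join_columns (col p ord0) [seq col p (lift ord0 y) | y <- enum 'I_r].

Lemma count_col p x l : count_mem l (col p x) = mult p x l.
Proof.
rewrite /col count_sort count_flatten -map_comp sumnE big_map big_enum /=.
rewrite (bigD1 l) //= count_nseq /= eqxx mul1n big1 ?addn0 // => l' /negPf ne.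
by rewrite count_nseq /= ne.
Qed.

Lemma size_col p x : size (col p x) = col_size p x.
Proof.
rewrite /col size_sort size_flatten /shape -map_comp sumnE big_map big_enum /=.
by apply: eq_bigr => l _; rewrite size_nseq.
Qed.

Lemma cols_enum p :
  col p ord0 :: [seq col p (lift ord0 y) | y <- enum 'I_r] =
  map (col p) (enum 'I_r.+1).
Proof. by rewrite enum_ordSl /= -map_comp. Qed.

Lemma word_inj p q : word p = word q -> p = q.
Proof.
move=> E; have: columns (word p) = columns (word q) by rewrite E.
rewrite !join_columnsK => -[E0 Es]; apply: mult_inj => x l.
have : map (col p) (enum 'I_r.+1) = map (col q) (enum 'I_r.+1).
  by rewrite -!cols_enum E0 Es.
by move/eq_in_map/(_ x (mem_enum _ _)); rewrite -!count_col => ->.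
Qed.

Lemma word_unbarred_once p : unbarred_once (word p).
Proof.
apply/forallP => j; rewrite count_label_join cols_enum -map_comp sumnE big_map big_enum /=.
by rewrite (eq_bigr _ (fun x _ => count_col p x (inr j))) sum_mult_unbarred.
Qed.

Lemma word_runs_increasing p : runs_increasing (word p).
Proof.
rewrite /runs_increasing (sorted_join (le := @label_le k i)) //; last by case.
by rewrite cols_enum all_map; apply/allP => x _; exact/sort_sorted/label_le_total.
Qed.

Lemma word_is_dyck p : is_dyck r (word p) = balanced p && parking p.
Proof.
rewrite is_dyck_join; last by rewrite size_map size_enum_ord.
rewrite cols_enum -map_comp.
rewrite (eq_map (g := col_size p)); last exact: size_col.
rewrite sumnE big_map big_enum balancedE; congr (_ && _).
apply/allP/forallP => [H t|H t].
  by rewrite -sumn_take_enum; apply: H; rewrite mem_iota /= ltn_ord.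
by rewrite mem_iota sumn_take_enum => /= tr; exact: (H (Ordinal tr)).
Qed.

Lemma size_word p : balanced p -> size (word p) = r + r.
Proof.
rewrite balancedE => /eqP pr; rewrite -(count_predC (fun o => isSome o)) count_north_join.
rewrite [X in _ + X]count_east_join size_map size_enum_ord cols_enum -map_comp sumnE big_map big_enum.
by congr (_ + _); apply: etrans pr; apply: eq_bigr => x _; exact: size_col.
Qed.

(** The label multiplicities in the columns of [w] define [p]; a sorted column is determined by its
    multiplicities because the label order is antisymmetric. *)
Lemma word_onto (w : seq (step k i)) :
    is_dyck r w -> unbarred_once w -> runs_increasing w ->
  {p | balanced p & word p = w}.
Proof.
rewrite -(columnsK w); case: (columns w) => c cs /= wd w1 ws.
have cs_r : size cs = r by case/and3P: wd => /eqP; rewrite count_east_join.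
move: wd ws; rewrite is_dyck_join // => /andP[/eqP wr _].
rewrite /runs_increasing (sorted_join (le := @label_le k i)) //; last by case.
move=> ws.
pose f (x : 'I_r.+1) := nth [::] (c :: cs) x.
have csE : c :: cs = map f (enum 'I_r.+1).
  rewrite -[LHS](mkseq_nth [::]) -[size _]/(size cs).+1 cs_r /mkseq.
  by rewrite -val_enum_ord -map_comp.
have [j||p pb pf] := @config_of_mult (fun x l => count_mem l (f x)).
- have /forallP/(_ j)/eqP := w1; rewrite count_label_join csE -map_comp.
  by rewrite sumnE big_map big_enum.
- move: wr; rewrite csE -map_comp sumnE big_map big_enum /= => wr.
  apply: etrans wr; apply: eq_bigr => x _; rewrite -[RHS]sum1_size.
  elim: (f x) => [|l s IH] /=; first by rewrite big_nil big1.
  rewrite big_split IH big_cons /= (bigD1 l) //= eqxx big1 // => l' /negPf.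
  by rewrite eq_sym => ->.
exists p => //; have colE x : col p x = f x.
  apply: (sorted_eq (@label_le_trans k i) (@label_le_anti k i)).
  - exact/sort_sorted/label_le_total.
  - by move: ws; rewrite csE all_map => /allP/(_ x (mem_enum _ _)).
  by apply/allP => l _ /=; rewrite count_col pf.
have := cols_enum p; rewrite (eq_map colE) -csE /word => -[-> ->].
by [].
Qed.

Lemma card_multi_labeled_dyck :
  #|multi_labeled_dyck k r i| = #|[set p | balanced p && parking p]|.
Proof.
(* The all-east default only makes [psi] total; balanced configurations give words of the right
   length. *)
pose psi p : (r + r).-tuple (step k i) :=
  insubd [tuple of nseq (r + r) None] (word p).
have psiE p : balanced p -> psi p = word p :> seq _.
  by move=> pb; rewrite val_insubd size_word ?eqxx.
rewrite -(card_in_imset (f := psi)); last first.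
  move=> p q; rewrite !inE => /andP[pb _] /andP[qb _] /(congr1 val) /=.
  by rewrite !psiE // => /word_inj.
apply: eq_card => w; rewrite inE; apply/and3P/imsetP => [[wd w1 ws]|[p + ->]].
  have [p pb pw] := word_onto wd w1 ws.
  exists p; first by rewrite inE -word_is_dyck pw.
  by apply/val_inj; rewrite /= psiE.
rewrite inE => /[dup] /andP[pb _]; rewrite -word_is_dyck => pd.
by rewrite psiE // word_unbarred_once word_runs_increasing.
Qed.

End Configurations.

(** * The closed formula over the rationals *)

Import Order.TTheory GRing.Theory Num.Theory.
Local Open Scope ring_scope.

Lemma binomz_nat (a m : nat) : binomz a m = 'C(a, m)%:R.
Proof.
rewrite /binomz; have -> : \prod_(j < m) ((a%:Z)%:~R - j%:R) = (a ^_ m)%:R :> rat.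
  elim: m => [|m IH]; first by rewrite big_ord0.
  rewrite big_ord_recr /= IH ffactnSr natrM.
  (* For [m] beyond [a] the truncated [a - m] is wrong, but [a ^_ m] already vanishes. *)
  case: (leqP m a) => [le|lt]; first by rewrite natrB.
  by rewrite ffact_small // !mul0r.
by rewrite -bin_ffact natrM mulfK // pnatr_eq0 -lt0n fact_gt0.
Qed.

Theorem theorem3p18 (k r i : nat) (hi : (i <= r)%N) :
  #|multi_labeled_dyck k r i|%:R =
    (r.+1%:R : rat) ^ (i%:Z - 1)
    * binomz (k%:Z * (r%:Z + 1) + r%:Z - 1 - i%:Z) (r - i)%N.
Proof.
have r1 : r.+1%:R != 0 :> rat by rewrite pnatr_eq0.
have -> : binomz (k%:Z * (r%:Z + 1) + r%:Z - 1 - i%:Z) (r - i) =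
    'C((r.+1 * k + (r - i)).-1, r - i)%:R.
  (* In the zero case the integer argument is -1 while [.-1] gives 0; then [r - i] is 0 and both
     coefficients are 1. *)
  case E: (r.+1 * k + (r - i))%N => [|n].
    have -> : (r - i = 0)%N by lia.
    by rewrite bin0 /binomz big_ord0 fact0 divr1.
  by rewrite /= -binomz_nat; congr binomz; lia.
(* Multiplying by [r + 1] brings in [card_parking] and cancels the -1 in the exponent. *)
apply: (mulfI r1); rewrite -natrM card_multi_labeled_dyck // card_parking //.
rewrite card_balanced natrM natrX mulrA mulrC expfzDr // mulrCA.
by rewrite -[r.+1%:R ^ (-1)]/(r.+1%:R^-1) mulfV // mulr1.
Qed.
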